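(* Let $G$ be a connected graph of order at least $3$. Then $vcfc(G)=2$ if and only if $G$ is $2$-connected or $G$ has exactly one cut vertex.
   Context: Vertex-colorings are arbitrary, not necessarily proper. A path in a vertex-colored graph is called conflict-free if there is a color used on exactly one of its vertices. A vertex-colored graph is conflict-free vertex-connected if any two vertices of the graph are connected by a conflict-free path. For a connected graph $G$, the conflict-free vertex-connection number $vcfc(G)$ is the smallest number of colors needed in a vertex-coloring of $G$ that makes $G$ conflict-free vertex-connected. *)

(* Defs.v *)
From mathcomp Require Import all_boot.

Set Implicit Arguments.
Unset Strict Implicit.
Unset Printing Implicit Defensive.

(* A simple graph is a symmetric irreflexive relation [e] on a finType [T];
   symmetry and irreflexivity are hypotheses of the theorems. *)
Section Graph.

Variables (T : finType) (e : rel T).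

Definition induced (A : {set T}) : rel T :=
  [rel x y | [&& x \in A, y \in A & e x y]].

Definition connected : bool := [forall x, forall y, connect e x y].

Definition connected_on (A : {set T}) : bool :=
  [forall x in A, forall y in A, connect (induced A) x y].

Definition k_connected (k : nat) : bool :=
  (k < #|T|) && [forall X : {set T}, (#|X| < k) ==> connected_on (~: X)].

(* Deleting [v] increases the number of connected components. *)
Definition cut_vertex (v : T) : bool :=
  n_comp e predT < n_comp (induced [set~ v]) [set~ v].

(* [x :: s] is the vertex sequence of a path without repeated vertices; the
   colouring [c] need not be proper. *)
Definition conflict_free_path (k : nat) (c : {ffun T -> 'I_k})
    (x : T) (s : seq T) : bool :=
  [&& path e x s, uniq (x :: s)
    & [exists a : 'I_k, count (fun v => c v == a) (x :: s) == 1]].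

(* Bounding the length by [#|T|] loses nothing, as the vertices of a path are
   distinct; it makes the quantifier over paths finite. *)
Definition conflict_free_vertex_connected (k : nat) (c : {ffun T -> 'I_k}) :
    bool :=
  [forall x, forall y, (x != y) ==>
    [exists s : #|T|.-bseq T, conflict_free_path c x s && (last x s == y)]].

Definition vcfc_colorable (k : nat) : bool :=
  [exists c : {ffun T -> 'I_k}, conflict_free_vertex_connected c].

(* An injective colouring of a connected graph works. *)
Lemma vcfc_colorable_exists : connected -> exists k, vcfc_colorable k.
Proof.
move=> /forallP conn; exists #|T|; apply/existsP.
exists [ffun v => enum_rank v]; apply/forallP => x; apply/forallP => y.
apply/implyP => _; have /forallP/(_ y)/connectP[p0 p0P ->] := conn x.
case/shortenP: p0P => p pP pU _.
have szp : size p <= #|T|.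
  by move: pU => /= /andP[_ /card_uniqP <-]; apply: max_card.
apply/existsP; exists (Bseq szp); rewrite eqxx andbT /conflict_free_path pP pU /=.
apply/existsP; exists (enum_rank x); rewrite ffunE eqxx /=.
rewrite (@eq_count _ _ (pred1 x)) => [|v]; last first.
  by rewrite /= ffunE (inj_eq enum_rank_inj).
by move: pU => /= /andP[/count_memPn -> _].
Qed.

Definition vcfc (conn : connected) : nat := ex_minn (vcfc_colorable_exists conn).

End Graph.

(* Main.v *)
(** With two colours, a path is conflict-free iff one of its vertices has a
    colour different from that of all the others.

    If [u] and [w] are two cut vertices, choose a vertex [a] separated from [w]
    by [u] with [c a <> c u] and a vertex [b] separated from [u] by [w] with
    [c b <> c w]: a path from [a] to [b] visits [a], [u], [w], [b], so it uses
    both colours at least twice.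

    Conversely, if no vertex other than [v] is a cut vertex, then any two
    vertices are the ends of a path through [v], so it suffices to give [v] a
    colour of its own. *)
Require Import Defs.
From mathcomp Require Import all_boot.
From mathcomp Require Import zify.

Set Implicit Arguments.
Unset Strict Implicit.
Unset Printing Implicit Defensive.

Section Graph.

Variables (T : finType) (e : rel T).
Hypothesis e_sym : symmetric e.

(** * Paths avoiding a vertex, and cut vertices *)

Lemma induced_sym (A : {set T}) : symmetric (induced e A).
Proof. by move=> x y; rewrite /induced /= e_sym andbCA. Qed.

Lemma path_induced (A : {set T}) x s :
  x \in A -> path (induced e A) x s = path e x s && all (mem A) s.
Proof.
elim: s x => //= y s IH x xA; rewrite /induced /= xA /= -/(induced e A).
case: (boolP (y \in A)) => [yA|_] /=; last by rewrite andbF.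
by rewrite IH // andbA.
Qed.

Lemma connected_onC1P u :
  reflect (forall x y, x != u -> y != u -> connect (induced e [set~ u]) x y)
          (connected_on e [set~ u]).
Proof.
apply: (iffP forall_inP) => [H x y xu yu | H x].
  by apply: (forall_inP (H x _)); rewrite !inE.
by rewrite !inE => xu; apply/forall_inP => y; rewrite !inE => yu; apply: H.
Qed.

Lemma connect_inducedC1 u x s :
  path e x s -> u \notin x :: s -> connect (induced e [set~ u]) x (last x s).
Proof.
rewrite inE negb_or eq_sym => xs /andP[xu us]; apply/connectP; exists s => //.
rewrite path_induced ?inE // xs /=; apply/allP => z zs.
by rewrite !inE; apply: contraNneq us => <-.
Qed.

Lemma connect_inducedC1_path u x y :
    connect (induced e [set~ u]) x y -> x != u ->
  exists s, [/\ path e x s, uniq (x :: s), last x s = y & u \notin x :: s].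
Proof.
move=> /connectP[p0 p0P ->] xu; case/shortenP: p0P => p + pU _.
rewrite path_induced ?inE // => /andP[pP /allP pA]; exists p; split=> //.
rewrite inE negb_or eq_sym xu; apply/negP => /pA; by rewrite !inE eqxx.
Qed.

Lemma connected_n_comp : connected e -> n_comp e predT <= 1.
Proof.
move=> /forallP conn; rewrite /n_comp_mem leqNgt; apply/negP =>
  /card_gt1P[x [y]].
rewrite !inE !andbT => -[/eqP rx /eqP ry]; rewrite -rx -ry => /eqP[].
by apply/rootP => //; [exact: sym_connect_sym | exact: (forallP (conn x))].
Qed.

Lemma n_comp_gt0 : 0 < #|T| -> 0 < n_comp e predT.
Proof.
move=> /card_gt0P[x _]; rewrite /n_comp_mem; apply/card_gt0P; exists (root e x).
by rewrite !inE andbT; apply: roots_root; apply: sym_connect_sym.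
Qed.

(** As [u] exists, the connected graph has exactly one component, so the number of components after
    the deletion is compared with 1. Components are counted by their roots. *)
Lemma cut_vertexE u : connected e ->
  cut_vertex e u = ~~ connected_on e [set~ u].
Proof.
move=> conn; have n1 : n_comp e predT = 1.
  apply/eqP; rewrite eqn_leq connected_n_comp // n_comp_gt0 //.
  by apply/card_gt0P; exists u.
rewrite /cut_vertex n1; set e' := induced e _.
have sym' : connect_sym e' by apply/sym_connect_sym/induced_sym.
apply/idP/idP.
  move=> /card_gt1P[x [y [/andP[/= rx xu] /andP[/= ry yu] xy]]].
  apply: contra_neqN xy => /connected_onC1P/(_ x y).
  move: xu yu; rewrite !inE => xu yu /(_ xu yu) /(rootP sym').
  by rewrite (eqP rx) (eqP ry).
apply: contraNT; rewrite -leqNgt => le1; apply/connected_onC1P => x y xu yu.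
(* Only roots inside [[set~ u]] are counted. The root of [z] is one of them, being the end of an
   induced path that starts off [u]. *)
have root_in z : z != u -> root e' z \in [predI roots e' & [set~ u]].
  move=> zu; apply/andP; split; first exact: roots_root.
  have /connectP[p pP ->] := connect_root e' z.
  case/lastP: p pP => [|p t] /=; first by rewrite !inE.
  by rewrite rcons_path last_rcons => /andP[_ /and3P[]].
by apply/(rootP sym'); apply: (card_le1_eqP le1); apply: root_in.
Qed.

(* [x] cannot be separated both from [w] by [u] and from [u] by [w]. *)
Lemma connect_inducedC1_either u w x :
    connected e -> x != u -> w != u ->
  connect (induced e [set~ u]) x w || connect (induced e [set~ w]) x u.
Proof.
move=> /forallP/(_ x)/forallP/(_ w)/connectP[p0 p0P ->] xu.
case/shortenP: p0P => p pP pU _ wu.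
(* The path is simple and ends at [w], so if it meets [u], its part up to [u] avoids [w]. *)
have [up|up] := boolP (u \in x :: p); last by rewrite connect_inducedC1.
move: up; rewrite inE eq_sym (negPf xu) /= => up.
case/splitPr: up pP pU wu => p1 p2; rewrite cat_path last_cat.
move=> /and3P[p1P up _] pU /= wu; apply/orP; right.
have := @connect_inducedC1 (last u p2) x (rcons p1 u).
rewrite last_rcons rcons_path p1P up; apply=> //.
case/lastP: p2 wu pU => [|p2 t]; first by rewrite /= eqxx.
rewrite last_rcons -cat_rcons -cat_cons => _.
rewrite cat_uniq => /and3P[_ /hasPn dis _]; apply: dis.
by rewrite mem_rcons mem_head.
Qed.

(** * Conflict-free colourings and cut vertices *)

Section Coloring.

Variables (k : nat) (c : {ffun T -> 'I_k}).

Lemma conflict_free_path_const x s a :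
  conflict_free_path e c x s -> {in x :: s, forall z, c z = a} -> s = [::].
Proof.
move=> /and3P[_ _ /existsP[b /eqP cnt]] cs.
have [ab|ab] := eqVneq a b.
  have : all (fun v => c v == b) (x :: s) by apply/allP => z /cs ->; rewrite ab.
  by rewrite all_count cnt /= eqSS eq_sym => /nilP.
move: cnt; rewrite (@eq_in_count _ _ pred0) ?count_pred0 // => z /cs ->.
exact/negbTE.
Qed.

Lemma conflict_free_vertex_connectedP :
  reflect (forall x y, x != y ->
             exists2 s, conflict_free_path e c x s & last x s = y)
          (conflict_free_vertex_connected e c).
Proof.
apply: (iffP idP) => [/forallP H x y xy | H].
  have /forallP/(_ y) := H x; rewrite xy => /existsP[s /andP[sP /eqP sy]].
  by exists s.
apply/forallP => x; apply/forallP => y; apply/implyP => /H[s sP sy].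
have szs : size s <= #|T|.
  by case/and3P: sP => _ /= /andP[_ /card_uniqP <-] _; apply: max_card.
by apply/existsP; exists (Bseq szs); rewrite /= sP sy eqxx.
Qed.

Hypothesis c_conn : conflict_free_vertex_connected e c.

Lemma cfvc_gt1 : 1 < #|T| -> 1 < k.
Proof.
move=> /card_gt1P[x [y [_ _ xy]]].
have [s sP sy] := conflict_free_vertex_connectedP c_conn x y xy.
rewrite ltnNge; apply/negP => k1.
suff s0 : s = [::] by rewrite -sy s0 eqxx in xy.
apply: conflict_free_path_const (c x) sP _ => z _; apply: ord_inj.
have lt1 (i : 'I_k) : i < 1 := leq_trans (ltn_ord i) k1.
by have := lt1 (c z); have := lt1 (c x); rewrite !ltnS !leqn0 => /eqP-> /eqP->.
Qed.

(** Take [a0] separated from [w] by [u]. A conflict-free path from [a0] to [u] is not monochromatic,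
    so some [a] on it has a colour other than that of [u]. The part of the path from [a0] to [a]
    avoids [u], hence [a] is separated from [w] as well. *)
Lemma cut_vertex_other_color u w :
    connected e -> cut_vertex e u -> w != u ->
  exists a, [/\ a != u, ~~ connect (induced e [set~ u]) a w & c a != c u].
Proof.
set e' := induced e _ => conn; rewrite cut_vertexE // => cutu wu.
have sym' : connect_sym e' by apply/sym_connect_sym/induced_sym.
have [a0 a0u a0w] : exists2 a, a != u & ~~ connect e' a w.
  have [/existsP[a /andP[]]|/existsPn H] :=
    boolP [exists a, (a != u) && ~~ connect e' a w]; first by exists a.
  case/connected_onC1P: cutu => x y xu yu; have cw z : z != u -> connect e' z w.
    by move=> zu; have := H z; rewrite zu negbK.
  by apply: connect_trans (cw x xu) _; rewrite sym'; apply: cw.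
have [s sP su] := conflict_free_vertex_connectedP c_conn a0 u a0u.
have [/hasP[a a_s cau]|/hasPn H] := boolP (has (fun z =>
  c z != c u) (a0 :: s)); last first.
  have s0 : s = [::].
    by apply: conflict_free_path_const (c u) sP _ => z /H; rewrite negbK =>
      /eqP.
  by rewrite -su s0 eqxx in a0u.
have au : a != u by apply: contraNneq cau => ->.
exists a; split=> //; apply: contraNN a0w; apply: connect_trans.
case/and3P: sP => sP sU _; move: sP sU su.
case/splitPl: a_s => p1 p2 lasta;
  rewrite cat_path -cat_cons cat_uniq last_cat lasta.
move=> /andP[p1P _] /and3P[_ /hasPn dis _] su; rewrite -lasta;
  apply: connect_inducedC1 => //.
apply: dis; rewrite -su; case: p2 su => [/eqP|z p2 _];
  first by rewrite (negPf au).
by rewrite /= mem_last.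
Qed.

Lemma count_color1 s z1 z2 (a : 'I_k) :
    count (fun v => c v == a) s = 1 -> z1 \in s -> z2 \in s ->
  c z1 = a -> c z2 = a -> z1 = z2.
Proof.
rewrite -size_filter; set f := filter _ _ => sz z1s z2s c1 c2.
have : z1 \in f by rewrite mem_filter c1 eqxx.
have : z2 \in f by rewrite mem_filter c2 eqxx.
by case: f sz => [|t []] // _; rewrite !inE => /eqP-> /eqP->.
Qed.

End Coloring.

Lemma ord2_dichotomy (i j a : 'I_2) : i != j -> i = a \/ j = a.
Proof.
by case: i j a => [[|[|i]] ?] [[|[|j]] ?] [[|[|a]] ?] //= _;
  solve [left; apply: ord_inj => // | right; apply: ord_inj => //].
Qed.

Lemma cfvc2_cut_vertex_inj (c : {ffun T -> 'I_2}) u w :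
    connected e -> conflict_free_vertex_connected e c ->
  cut_vertex e u -> cut_vertex e w -> u = w.
Proof.
move=> conn c_conn cutu cutw; apply/eqP; apply: contraT => uw.
have wu : w != u by rewrite eq_sym.
have [a [au aw cau]] := cut_vertex_other_color c_conn conn cutu wu.
have [b [bw bu cbw]] := cut_vertex_other_color c_conn conn cutw uw.
have a_w : a != w by apply: contraNneq aw => ->.
have b_u : b != u by apply: contraNneq bu => ->.
(* Since [w] separates [b] from [u], the vertex [b] reaches [w] without [u]; if [a] reached [b]
   without [u], it would then reach [w] too. *)
have aub : ~~ connect (induced e [set~ u]) a b.
  apply: contraNN aw => /connect_trans; apply.
  by have := connect_inducedC1_either conn b_u wu; rewrite (negPf bu) orbF.
have awb : ~~ connect (induced e [set~ w]) a b.
  apply: contraNN bu; rewrite (sym_connect_sym (induced_sym _)) =>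
    /connect_trans; apply.
  by have := connect_inducedC1_either conn au wu; rewrite (negPf aw).
have ab : a != b by apply: contraNneq aub => ->.
have [s /and3P[sP sU /existsP[i /eqP cnt]] sb] :=
  conflict_free_vertex_connectedP c c_conn a b ab.
have us : u \in a :: s by apply: contraNT aub => us;
  rewrite -sb connect_inducedC1.
have ws : w \in a :: s by apply: contraNT awb => ws;
  rewrite -sb connect_inducedC1.
have as_ : a \in a :: s by rewrite mem_head.
have bs : b \in a :: s by rewrite -sb mem_last.
have H := count_color1 cnt.
(* Each of the pairs [a], [u] and [b], [w] shows both colours, so each contains a vertex of colour
   [i]. As [i] occurs once on the path, these two vertices coincide, but the pairs are disjoint. *)
case: (ord2_dichotomy i cau) => c1; case: (ord2_dichotomy i cbw) => c2.
- by rewrite (H a b) ?eqxx in ab.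
- by rewrite (H a w) ?eqxx in a_w.
- by rewrite (H b u) ?eqxx in b_u.
- by rewrite (H u w) ?eqxx in uw.
Qed.

(** * Fans from a vertex, and paths through it *)

Lemma last_exit (A : {pred T}) x s :
    path e x s -> uniq (x :: s) -> x \in A ->
  exists z r, [/\ z \in A, path e z r, last z r = last x s, uniq r
    & {subset r <= s} /\ ~~ has (mem A) r].
Proof.
have [n] := ubnP (size s); elim: n s x => // n IH s x; rewrite ltnS =>
  szs xs Us xA.
have [/hasP[z zs zA]|] := boolP (has (mem A) s); last first.
  by case/andP: Us => _ Us ?; exists x, s; split=> //; split.
case/splitPr: zs szs xs Us => p1 p2; rewrite size_cat addnS cat_path.
move=> szs /and3P[_ _ zp2]; rewrite -cat_cons cat_uniq => /and3P[_ _ zU].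
(* The path re-enters [A] at [z]: start again from there, with the shorter tail [p2]. *)
have [|t [r [tA tr lastr rU [rp2 rA]]]] := IH p2 z _ zp2 zU zA.
  by apply: leq_trans szs; rewrite ltnS leq_addl.
exists t, r; split=> //; first by rewrite lastr last_cat.
by split=> // y /rp2 yp2; rewrite mem_cat inE yp2 !orbT.
Qed.

(* Two paths from [v], to [x] and to [y], that share only [v]. *)
Definition fan v x y := exists p q,
  [/\ path e v p, path e v q, last v p = x, last v q = y & uniq (v :: p ++ q)].

Lemma fan_sym v x y : fan v x y -> fan v y x.
Proof.
by move=> [p [q [pP qP px qy U]]]; exists q, p; split; rewrite //= mem_cat orbC
  -mem_cat uniq_catC.
Qed.

Lemma fan_apex v y : connect e v y -> fan v v y.
Proof. by case/connectP=> p0 /shortenP[q qP qU _] ->; exists [::], q. Qed.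

(* [rcons p x] and [rcons q x] form a cycle through [v] and [x]; a path from [v]
   to [y] that avoids [x] leaves this cycle for the last time at [z] on the
   [p] side, say: then [rcons q x] is disjoint from the path along [p] up to [z]
   and on to [y]. *)
Lemma fan_cycle v x y p q :
    path e v (rcons p x) -> path e v (rcons q x) ->
    uniq (x :: v :: p ++ q) -> connect (induced e [set~ x]) v y ->
  fan v x y.
Proof.
move=> pP qP U vy.
have vx : v != x by move: U; rewrite /= inE negb_or eq_sym => /andP[/andP[]].
have [s [sP sU sy xs]] := connect_inducedC1_path vy vx.
have [//|z [r [zA zr lastr rU [rs rA]]]] :=
  @last_exit [in v :: p ++ q] v s sP sU; first exact: mem_head.
have {}U : uniq ((x :: v :: p ++ q) ++ r).
  rewrite cat_uniq U rU andbT /=; apply: contra rA => /hasP[t tr].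
  rewrite inE => /predU1P[tx|tA]; last by apply/hasP; exists t.
  by move: xs; rewrite inE -tx rs ?orbT.
wlog zp : p q pP qP U zA {rA} / z \in v :: p => [H|].
  have [|zp] := boolP (z \in v :: p); first exact: (H p q).
  have zq : z \in q by move: zA zp; rewrite !inE mem_cat orbA => /orP[->|].
  apply: (H q p) => //; last by rewrite inE zq orbT.
    rewrite (perm_uniq (_ : perm_eq _ ((x :: v :: p ++ q) ++ r))) //.
    by rewrite perm_cat2r !perm_cons perm_catC.
  by rewrite inE mem_cat zq orbT.
case/splitPl: zp pP U zA => p1 p2 lastz pP U _.
exists (rcons q x), (p1 ++ r); split=> //.
- by move: pP; rewrite rcons_path !cat_path lastz zr => /andP[/andP[->]].
- by rewrite last_rcons.
- by rewrite last_cat lastz lastr.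
(* Putting back [p2], the part of [p] beyond [z] that the new fan drops, gives a permutation of the
   list in [U]. *)
suff : uniq (p2 ++ v :: rcons q x ++ p1 ++ r) by rewrite cat_uniq => /and3P[].
rewrite (perm_uniq (_ : perm_eq _ ((x :: v :: (p1 ++ p2) ++ q) ++ r))) //.
by apply/permP => f; rewrite -cats1 /=; do !rewrite count_cat /=; lia.
Qed.

(** One end of the fan moves along an edge. If [x'] lies on [p], cut [p] there; if it lies on
    neither path, append it to [p]. If it lies on [q], then [p] and the part of [q] before [x']
    close up to a cycle through [v] and [x'], and [fan_cycle] applies. *)
Lemma fan_step v x x' y :
    e x x' -> connect e v y -> x' != y ->
    (x' != v -> connect (induced e [set~ x']) v y) ->
  fan v x y -> fan v x' y.
Proof.
move=> xx' vy x'y Hx' [p [q [pP qP px qy U]]].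
have [->|x'v] := eqVneq x' v; first exact: fan_apex.
have [x'p|x'p] := boolP (x' \in p).
  case/splitPr: x'p pP px U => p1 p2; rewrite -cat_rcons cat_path =>
    /andP[p1P _] _ U.
  exists (rcons p1 x'), q; split; rewrite ?last_rcons //.
  apply: subseq_uniq U; rewrite /= eqxx -catA; apply: cat_subseq => //.
  exact: suffix_subseq.
have [x'q|x'q] := boolP (x' \in q); last first.
  exists (rcons p x'), q; split; rewrite ?last_rcons ?rcons_path ?pP ?px //.
  have -> : uniq (v :: rcons p x' ++ q) = uniq (x' :: v :: p ++ q).
    by apply: perm_uniq; apply/permP => f; rewrite -cats1 /=;
      do !rewrite count_cat /=; lia.
  by rewrite cons_uniq U inE mem_cat !negb_or x'v x'p x'q.
case/splitPr: x'q qP qy U => q1 q2; rewrite -cat_rcons cat_path =>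
  /andP[q1P _] _ U.
apply: (@fan_cycle _ _ _ p q1) => //; last exact: Hx'.
  by rewrite rcons_path pP px.
suff : uniq (q2 ++ x' :: v :: p ++ q1) by rewrite cat_uniq => /and3P[].
rewrite -(perm_uniq (_ : perm_eq (v :: p ++ rcons q1 x' ++ q2) _)) //.
by apply/permP => f; rewrite -cats1 /=; do !rewrite count_cat /=; lia.
Qed.

(** Starting from the degenerate fan with ends [v] and [y], the first end is moved by [fan_step]
    along a path from [v] to [x] that avoids [y]. *)
Lemma fan_exists v x y :
    connected e -> (forall w, w != v -> connected_on e [set~ w]) -> x != y ->
  fan v x y.
Proof.
move=> /forallP conn H xy;
  have {conn} conn z : connect e v z by apply: (forallP (conn v)).
have [->|yv] := eqVneq y v; first exact/fan_sym/fan_apex.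
have vy : v != y by rewrite eq_sym.
have /connect_inducedC1_path[//|t [tP _ <- yt]] :=
  connected_onC1P _ (H y yv) v x vy xy.
have : y \notin t by move: yt; rewrite inE negb_or => /andP[].
elim/last_ind: t tP {yt} => [|t z IH]; first by move=> _ _; apply: fan_apex.
rewrite rcons_path last_rcons mem_rcons inE negb_or =>
  /andP[tP tz] /andP[yz yt].
apply: fan_step tz _ _ _ (IH tP yt) => //; first by rewrite eq_sym.
by move=> zv; apply: (connected_onC1P _ (H z zv)) => //; rewrite eq_sym.
Qed.

Lemma fan_path v x y : fan v x y ->
  exists s, [/\ path e x s, uniq (x :: s), last x s = y & v \in x :: s].
Proof.
move=> [p [q [pP qP <- <- U]]].
(* The path wanted runs backwards along [p] to [v], then along [q]. *)
have E : last v p :: rev (belast v p) = rev (v :: p) by rewrite [v :: p]lastI rev_rcons.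
have lastE : last (last v p) (rev (belast v p)) = v.
  by rewrite -[LHS]/(last v (last v p :: _)) E rev_cons last_rcons.
exists (rev (belast v p) ++ q); rewrite -cat_cons E; split.
- rewrite cat_path lastE qP andbT rev_path (eq_path (e' := e)) // => a b;
  exact: e_sym.
- have -> // : uniq (rev (v :: p) ++ q) = uniq (v :: p ++ q).
  by rewrite -cat_cons; apply: perm_uniq; rewrite perm_cat2r perm_rev.
- by rewrite last_cat lastE.
- by rewrite mem_cat mem_rev mem_head.
Qed.

(** * Two colours and the number of cut vertices *)

Lemma vcfc_colorable2 v :
    connected e -> (forall w, w != v -> connected_on e [set~ w]) ->
  vcfc_colorable e 2.
Proof.
move=> conn H; apply/existsP; exists [ffun z =>
  if z == v then ord0 else ord_max].
apply/conflict_free_vertex_connectedP => x y xy.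
have [s [sP sU sy vs]] := fan_path (fan_exists conn H xy).
exists s => //; apply/and3P; split=> //; apply/existsP; exists ord0.
rewrite (eq_count (a2 := pred1 v)) => [|z]; last by rewrite /= ffunE;
  case: (z == v).
by rewrite count_uniq_mem // vs.
Qed.

Lemma k_connected2E : connected e -> 2 < #|T| ->
  k_connected e 2 = (#|[set v | cut_vertex e v]| == 0).
Proof.
move=> conn T3; rewrite /k_connected T3 cards_eq0; apply/forallP/eqP =>
  [H | H0 X].
  apply/setP => v; rewrite !inE cut_vertexE //; apply/negbTE; rewrite negbK.
  by apply: (implyP (H [set v])); rewrite cards1.
(* A set of fewer than two vertices is a singleton or empty; deleting the empty set leaves the
   relation [e] itself. *)
apply/implyP; rewrite ltnS leq_eqVlt ltnS leqn0 cards_eq0.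
case/predU1P=> [/eqP/cards1P[v ->]|/eqP->].
  apply: contraT; rewrite -cut_vertexE // => cutv.
  by have := in_set0 v; rewrite -H0 inE cutv.
apply/forall_inP => x _; apply/forall_inP => y _.
rewrite (eq_connect (e' := e)) => [|a b]; last by rewrite /induced /= !inE.
exact: (forallP (forallP conn x)).
Qed.

Lemma vcfc_colorable2E : connected e -> 2 < #|T| ->
  vcfc_colorable e 2 = (#|[set v | cut_vertex e v]| <= 1).
Proof.
move=> conn T3; apply/idP/idP => [/existsP[c c_conn] | le1].
  rewrite leqNgt; apply/negP => /card_gt1P[u [w [+ + /eqP]]];
    rewrite !inE => cutu cutw.
  by apply; apply: (cfvc2_cut_vertex_inj conn c_conn).
(* Take the cut vertex if there is one, and any vertex otherwise. *)
have [v Hv] : exists v, forall w, w != v -> ~~ cut_vertex e w.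
  have [/existsP[v cutv]|/existsPn H] := boolP [exists v, cut_vertex e v].
    exists v => w; apply: contraNN => cutw.
    by apply/eqP; apply: (card_le1_eqP le1); rewrite inE.
  by have /card_gt0P[v _] := ltnW (ltnW T3); exists v.
by apply: (@vcfc_colorable2 v) => // w /Hv; rewrite cut_vertexE // negbK.
Qed.

(** One colour never suffices for two distinct vertices, so the minimum is 2 as soon as two colours
    do. *)
Lemma vcfc_eq2 (conn : connected e) : 1 < #|T| ->
  vcfc conn = 2 <-> vcfc_colorable e 2.
Proof.
move=> T2; rewrite /vcfc; case: ex_minnP => m mcol mmin;
  split=> [<- // | /mmin le2].
apply/eqP; rewrite eqn_leq le2; case/existsP: mcol => c c_conn.
exact: (cfvc_gt1 c_conn).
Qed.

End Graph.

Theorem theorem2 (T : finType) (e : rel T)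
    (e_sym : symmetric e) (e_irr : irreflexive e)
    (e_conn : connected e) (order_ge3 : 3 <= #|T|) :
  vcfc e_conn = 2 <->
  k_connected e 2 \/ #|[set v | cut_vertex e v]| = 1.
Proof.
rewrite vcfc_eq2 ?(ltnW order_ge3) // vcfc_colorable2E // k_connected2E //.
rewrite leq_eqVlt ltnS leqn0; split=> [/orP[/eqP|]|[->|->]];
  by [right | left | rewrite orbT |].
Qed.
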